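(* The function $M(q):=\Big(\prod_{k=1}^{\infty}(1-q^k)\Big)^3$ is convex on the interval $(0,1)$.
   Context: Here $q$ is a real variable; the infinite product converges for $q\in(-1,1)$. *)

(* Defs.v *)
From mathcomp Require Import all_boot all_order all_algebra.
From mathcomp Require Import all_classical all_reals all_analysis.
Import Order.TTheory GRing.Theory Num.Theory.
Import numFieldNormedType.Exports.

Set Implicit Arguments.
Unset Strict Implicit.
Unset Printing Implicit Defensive.

Local Open Scope classical_set_scope.
Local Open Scope ring_scope.

(* A bare limit of partial products: factors equal to 0 and a zero limit are
   allowed, and the value is unspecified when the partial products diverge. *)
Definition infprod (R : realType) (u : nat -> R) : R :=
  limn (fun n => \prod_(1 <= k < n.+1) u k).

Definition M (R : realType) (q : R) : R :=
  infprod (fun k => 1 - q ^+ k) ^+ 3.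

(* The limit used in M genuinely exists on ]0, 1[. *)
Lemma cvg_prod_1subXn (R : realType) (q : R) : 0 < q < 1 ->
  cvgn (fun n => \prod_(1 <= k < n.+1) (1 - q ^+ k)).
Proof.
move=> /andP[q0 q1].
have h k : 0 <= 1 - q ^+ k <= 1.
  by rewrite subr_ge0 gerBl exprn_ile1 ?exprn_ge0 ?ltW.
have p0 n : 0 <= \prod_(1 <= k < n.+1) (1 - q ^+ k).
  by apply: prodr_ge0 => k _; case/andP: (h k).
apply: nonincreasing_is_cvgn.
  apply/nonincreasing_seqP => n; rewrite [leLHS]big_nat_recr//=.
  by rewrite ler_piMr//; case/andP: (h n.+1).
by exists 0 => _ [n _ <-].
Qed.

(* Main.v *)
Require Import Defs.
From mathcomp Require Import all_boot all_order all_algebra.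
From mathcomp Require Import all_classical all_reals all_analysis.
From mathcomp Require Import ring lra.
Import Order.TTheory GRing.Theory Num.Theory.
Import numFieldNormedType.Exports.

Set Implicit Arguments.
Unset Strict Implicit.
Unset Printing Implicit Defensive.

Local Open Scope classical_set_scope.
Local Open Scope ring_scope.
Local Open Scope convex_scope.

(** Write x_k = q^k / (1 - q^k) and P_n = prod_(1 <= k <= n) (1 - q^k). The
    cubes P_n^3 are already convex on ]0, 1[, and convexity passes to the
    pointwise limit M.

    With the Euler operator theta = q d/dq, logarithmic differentiation gives
      theta P = - P S,   S = sum_(k <= n) k x_k,
      theta S = T,       T = sum_(k <= n) k^2 (x_k + x_k^2),
    and since q^2 d^2/dq^2 = theta^2 - theta,
      q^2 (P^3)'' = 3 P^3 (3 S^2 - T + S).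
    So everything rests on T - S <= 3 S^2, where
      T - S = sum_k k^2 x_k^2 + sum_k (k^2 - k) x_k.
    One copy of S^2 absorbs the squares, because all k x_k are nonnegative.
    The other two absorb the linear terms: x_i x_j >= x_(i+j), so grouping the
    products of S^2 by m = i + j <= n, and dropping those with i + j > n,
      S^2 >= sum_m x_m sum_(i < m) i (m - i) >= sum_m x_m m (m - 1) / 2,
    where the last step is i (m - i) >= i for i < m (lemma
    [sqr_sum_lambert_ge]).

    Each of these bounds holds at every finite n, so only polynomials have to
    be differentiated and no series or derivative is exchanged with the
    limit. *)

(** * Convexity of polynomials and of pointwise limits *)

Lemma conv_in_itv_oo (R : realType) (a b : R) (t : {i01 R}) (x y : R^o) :
  x \in `]a, b[ -> y \in `]a, b[ -> (x <| t |> y : R^o) \in `]a, b[.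
Proof.
wlog xy : t x y / x <= y.
  move=> le_conv xab yab; have [xy|/ltW yx] := leP x y; first exact: le_conv.
  by rewrite convC; exact: le_conv.
have := convR_itv t xy; rewrite !in_itv/=.
move=> /andP[xc cy] /andP[ax _] /andP[_ yb].
by rewrite (lt_le_trans ax)//= (le_lt_trans cy).
Qed.

Lemma convex_horner (R : realType) (a b : R) (p : {poly R}) :
  (forall x, x \in `]a, b[ -> 0 <= p^`()^`().[x]) ->
  convex_function (`]a, b[%classic : set R) (horner p : R -> R^o).
Proof.
move=> p2_ge0.
have le_conv (t : {i01 R}) (x y : R^o) : x \in `]a, b[ -> y \in `]a, b[ ->
    x <= y -> p.[x <| t |> y : R^o] <= (p.[x] : R^o) <| t |> p.[y].
  move=> xab yab xy.
  have DE : (fun z : R^o => derive (horner p : R -> R^o) z 1) = horner p^`().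
    by apply/funext => z; have [_ <-] := is_derive_poly p z.
  apply: second_derivative_convex => //.
  - move=> z zxy; rewrite DE.
    rewrite (_ : derive _ z _ = p^`()^`().[z]); last first.
      by have [_ <-] := is_derive_poly p^`() z.
    apply: p2_ge0.
    move: xab yab zxy; rewrite !in_itv/= => /andP[ax _] /andP[_ yb] /andP[xz zy].
    by rewrite (lt_trans ax)//= (lt_trans zy).
  - exact/cvg_at_left_filter/continuous_horner.
  - exact/cvg_at_right_filter/continuous_horner.
  - by rewrite DE => z _; exact: derivable_horner.
move=> t x y; rewrite !inE => xab yab.
have [xy|/ltW yx] := leP x y; first exact: le_conv.
by rewrite convC [leRHS]convC; exact: le_conv.
Qed.

Lemma convex_function_lim (R : realType) (D : set R) (f_ : nat -> R -> R)
    (f : R -> R) :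
  convex_set (D : set (convex_lmodType R^o)) ->
  (forall n, convex_function D (f_ n : R -> R^o)) ->
  (forall x, x \in D -> f_ n x @[n --> \oo] --> f x) ->
  convex_function D (f : R -> R^o).
Proof.
move=> cD cf ff t x y xD yD.
apply: (@ler_cvg_to _ \oo _ _ (fun n => f_ n (x <| t |> y))
  (fun n => (f_ n x : R^o) <| t |> f_ n y)).
- by apply: ff; exact: cD.
- rewrite convRE; under eq_fun do rewrite convRE.
  by apply: cvgD; apply: cvgM (cvg_cst _) (ff _ _).
- by near=> n; exact: cf.
Unshelve. all: by end_near. Qed.

(** * Finite sums *)

Lemma sum_antidiagonal (V : nmodType) n (F : nat -> nat -> V) :
  \sum_(0 <= i < n) \sum_(0 <= j < n - i) F i j =
  \sum_(0 <= m < n) \sum_(0 <= i < m.+1) F i (m - i)%N.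
Proof.
elim: n => [|n IH]; first by rewrite !big_nil.
rewrite [RHS]big_nat_recr//= -IH.
have -> : \sum_(0 <= i < n) \sum_(0 <= j < n - i) F i j =
    \sum_(0 <= i < n.+1) \sum_(0 <= j < n - i) F i j.
  by rewrite [RHS]big_nat_recr//= subnn (big_geq (leqnn 0)) addr0.
rewrite -big_split/=; apply: eq_big_nat => i /andP[_ ltin].
by rewrite subSn// big_nat_recr.
Qed.

Lemma sum_natr_double (R : comNzRingType) n :
  (\sum_(0 <= i < n) i%:R) *+ 2 = n%:R ^+ 2 - n%:R :> R.
Proof.
elim: n => [|n IH]; first by rewrite big_nil mul0rn expr0n subr0.
by rewrite big_nat_recr//= mulrnDl IH -natr1; ring.
Qed.

Lemma sum_sqr_le_sqr_sum (R : realDomainType) (n : nat) (a : nat -> R) :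
  (forall k, 0 <= a k) ->
  \sum_(0 <= k < n) a k ^+ 2 <= (\sum_(0 <= k < n) a k) ^+ 2.
Proof.
move=> a0; elim: n => [|n IH]; first by rewrite !big_nil expr0n.
rewrite !big_nat_recr//= sqrrD lerD2r (le_trans IH)// lerDl mulrn_wge0//.
by rewrite mulr_ge0// sumr_ge0.
Qed.

(** * The Lambert sums S and T *)

Definition lambert (R : realType) (q : R) (k : nat) : R := q ^+ k / (1 - q ^+ k).

Definition lambert_sum (R : realType) (q : R) (n : nat) : R :=
  \sum_(0 <= k < n) k%:R * lambert q k.

(** The image of [lambert_sum] under q d/dq, as theta x_k = k (x_k + x_k^2). *)
Definition theta_lambert_sum (R : realType) (q : R) (n : nat) : R :=
  \sum_(0 <= k < n) k%:R ^+ 2 * (lambert q k + lambert q k ^+ 2).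

Section Lambert.
Context {R : realType} (q : R).
Hypothesis q01 : 0 < q < 1.

Let q0 : 0 < q. Proof. by case/andP: q01. Qed.

Let qX_lt1 k : (0 < k)%N -> q ^+ k < 1.
Proof. by case/andP: q01 => q_gt0 q1 k0; rewrite exprn_ilt1 ?lt0n_neq0// ltW. Qed.

Lemma lambert_ge0 k : 0 <= lambert q k.
Proof.
(* At k = 0 the denominator vanishes and the quotient is 0 by convention. *)
have [->|k0] := posnP k; first by rewrite /lambert subrr invr0 mulr0.
by rewrite divr_ge0 ?exprn_ge0 ?subr_ge0 ?ltW// qX_lt1.
Qed.

Let wlambert_ge0 k : 0 <= k%:R * lambert q k.
Proof. exact: mulr_ge0 (ler0n R k) (lambert_ge0 k). Qed.

(** As 1/x_k + 1 = q^-k is multiplicative in k, in fact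
    x_i x_j = x_(i+j) (1 + x_i + x_j). *)
Lemma lambertD_le i j : (0 < i)%N -> (0 < j)%N ->
  lambert q (i + j) <= lambert q i * lambert q j.
Proof.
move=> i0 j0; have ij0 : (0 < i + j)%N by rewrite addn_gt0 i0.
rewrite /lambert mulf_div -exprD.
apply: ler_wpM2l; first by rewrite exprn_ge0// ltW.
rewrite lef_pV2 ?posrE ?mulr_gt0 ?subr_gt0 ?qX_lt1//.
(* With a = q^i and b = q^j, (1 - a) (1 - b) <= 1 - a b says 2 a b <= a + b,
   true since a, b < 1. *)
rewrite exprD; have [qi1 qj1] := (qX_lt1 i0, qX_lt1 j0).
have qi : 0 < q ^+ i by rewrite exprn_gt0.
have qj : 0 < q ^+ j by rewrite exprn_gt0.
nra.
Qed.

(** Only the products x_i x_j with i + j < n are kept; they are bounded below by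
    x_(i+j) and then collected along the antidiagonals i + j = m, whose
    weights satisfy 2 sum_(i < m) i (m - i) >= 2 sum_(i < m) i = m^2 - m. *)
Lemma sqr_sum_lambert_ge n :
  \sum_(0 <= k < n) (k%:R ^+ 2 - k%:R) * lambert q k <=
  lambert_sum q n ^+ 2 *+ 2.
Proof.
apply: (@le_trans _ _ ((\sum_(0 <= i < n) \sum_(0 <= j < n - i)
    i%:R * j%:R * lambert q (i + j)) *+ 2)).
  rewrite sum_antidiagonal -sumrMnl; apply: ler_sum_nat => m /andP[_ mn].
  rewrite big_nat_recr//= subnn mulr0 mul0r addr0.
  rewrite -sum_natr_double mulrnAl lerMn2r/= mulr_suml.
  apply: ler_sum_nat => i /andP[_ im]; rewrite subnKC ?(ltnW im)//.
  rewrite ler_wpM2r ?lambert_ge0// ler_peMr// ?ler0n//.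
  by rewrite ler1n subn_gt0.
rewrite lerMn2r/= expr2 mulr_suml; apply: ler_sum_nat => i /andP[_ lin].
rewrite mulr_sumr [leRHS](@big_cat_nat _ _ _ (n - i))//= ?leq_subr//.
rewrite ler_wpDr//.
  by apply: sumr_ge0 => j _; apply: mulr_ge0; exact: wlambert_ge0.
apply: ler_sum_nat => j _; rewrite [leRHS]mulrACA.
have [->|i0] := posnP i; first by rewrite !mul0r.
have [->|j0] := posnP j; first by rewrite !(mulr0n, mulr0, mul0r).
by rewrite ler_wpM2l ?mulr_ge0// lambertD_le.
Qed.

(** This is the sign of (P^3)'': one S^2 pays for the squares in T, the two others for
    the remaining linear terms. *)
Lemma lambert_sum_discr_ge0 n :
  0 <= lambert_sum q n ^+ 2 *+ 3 - theta_lambert_sum q n + lambert_sum q n.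
Proof.
have sq := @sum_sqr_le_sqr_sum R n _ wlambert_ge0.
have tri := sqr_sum_lambert_ge n.
have TE : theta_lambert_sum q n = lambert_sum q n +
    \sum_(0 <= k < n) (k%:R * lambert q k) ^+ 2 +
    \sum_(0 <= k < n) (k%:R ^+ 2 - k%:R) * lambert q k.
  by rewrite -!big_split/=; apply: eq_bigr => k _; ring.
rewrite -/(lambert_sum q n) in sq; lra.
Qed.

End Lambert.

(** * Derivatives of the partial products *)

Definition euler_poly (R : realType) (n : nat) : {poly R} :=
  \prod_(1 <= k < n.+1) (1 - 'X^k).

Lemma horner_euler_poly (R : realType) n (q : R) :
  (euler_poly R n).[q] = \prod_(1 <= k < n.+1) (1 - q ^+ k).
Proof.
by rewrite horner_prod; apply: eq_bigr => k _; rewrite !hornerE.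
Qed.

(** The formulas theta P = - P S and (theta^2 - theta) P = P (S^2 - T + S). They
    are proved by induction on the number of factors: for u = 1 - q^k,
    q u' = - u k x_k and q^2 u'' = - u (k^2 - k) x_k. *)
Lemma euler_poly_deriv (R : realType) (q : R) (q01 : 0 < q < 1) n :
  let P := euler_poly R n in
  let S := lambert_sum q n.+1 in
  let T := theta_lambert_sum q n.+1 in
  q * P^`().[q] = - P.[q] * S /\
  q ^+ 2 * P^`()^`().[q] = P.[q] * (S ^+ 2 - T + S).
Proof.
elim: n => [|n [IH1 IH2]] P S T.
  rewrite /P /S /T /lambert_sum /theta_lambert_sum /euler_poly big_geq// !big_nat1.
  rewrite -polyC1 derivC deriv0 !horner0 hornerC.
  by split; ring.
have qX1 : q ^+ n.+1 != 1.
  by case/andP: q01 => q0 q1; rewrite lt_eqF// exprn_ilt1 // ltW.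
have PE : P = euler_poly R n * (1 - 'X^(n.+1)) by rewrite /P /euler_poly big_nat_recr.
have SE : S = lambert_sum q n.+1 + n.+1%:R * lambert q n.+1.
  by rewrite /S /lambert_sum big_nat_recr.
have TE : T = theta_lambert_sum q n.+1 +
    n.+1%:R ^+ 2 * (lambert q n.+1 + lambert q n.+1 ^+ 2).
  by rewrite /T /theta_lambert_sum big_nat_recr.
move: IH1 IH2; rewrite PE SE TE.
set P0 := euler_poly R n; set S0 := lambert_sum q n.+1.
set T0 := theta_lambert_sum q n.+1.
set l := lambert q n.+1; set u := 1 - 'X^(n.+1) => IH1 IH2.
have uE : u.[q] = 1 - q ^+ n.+1 by rewrite !hornerE.
have u0 : 1 - q ^+ n.+1 != 0 by rewrite subr_eq0 eq_sym.
have lE : u.[q] * l = q ^+ n.+1 by rewrite uE /l /lambert mulrCA divff ?mulr1.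
have u1 : q * u^`().[q] = - u.[q] * (n.+1%:R * l).
  rewrite mulrCA mulNr lE derivB derivC derivXn sub0r hornerN hornerMn hornerXn.
  by rewrite exprS; ring.
have u2 : q ^+ 2 * u^`()^`().[q] = - u.[q] * ((n.+1%:R ^+ 2 - n.+1%:R) * l).
  rewrite mulrCA mulNr lE derivB derivC derivXn sub0r derivN derivMn derivXn.
  rewrite hornerN !hornerMn hornerXn -natr1.
  case: (n) => [|m]; first by rewrite !mul0rn; ring.
  by rewrite -natr1 !exprS /=; ring.
(* Abstract u, so that the product rules do not expand it as a sum. *)
clearbody u; rewrite !(derivM, derivD) !(hornerD, hornerM); split.
  transitivity (q * P0^`().[q] * u.[q] + P0.[q] * (q * u^`().[q])); first by ring.
  by rewrite IH1 u1; ring.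
transitivity (q ^+ 2 * P0^`()^`().[q] * u.[q] +
    (q * P0^`().[q]) * (q * u^`().[q]) *+ 2 +
    P0.[q] * (q ^+ 2 * u^`()^`().[q])); first by ring.
by rewrite IH1 IH2 u1 u2; ring.
Qed.

Lemma euler_poly_cube_deriv2_ge0 (R : realType) n (q : R) : q \in `]0, 1[ ->
  0 <= (euler_poly R n ^+ 3)^`()^`().[q].
Proof.
rewrite in_itv/= => q01; have [q0 q1] := andP q01.
have [] := euler_poly_deriv q01 n.
set P := euler_poly R n; set S := lambert_sum q n.+1.
set T := theta_lambert_sum q n.+1.
move=> P1 P2.
have P_ge0 : 0 <= P.[q].
  rewrite horner_euler_poly; apply: prodr_ge0 => k _.
  by rewrite subr_ge0 exprn_ile1// ltW.
clearbody P; rewrite -(@pmulr_rge0 _ (q ^+ 2)) ?exprn_gt0//.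
have -> : q ^+ 2 * (P ^+ 3)^`()^`().[q] = P.[q] ^+ 3 * (S ^+ 2 *+ 3 - T + S) *+ 3.
  transitivity (P.[q] ^+ 2 * (q ^+ 2 * P^`()^`().[q]) *+ 3 +
    P.[q] * (q * P^`().[q]) ^+ 2 *+ 6); last by rewrite P1 P2; ring.
  have -> : P ^+ 3 = P * (P * P) by ring.
  by rewrite !(derivM, derivD) !(hornerD, hornerM); ring.
by rewrite mulrn_wge0// mulr_ge0 ?exprn_ge0//; exact: lambert_sum_discr_ge0.
Qed.

(** * Passage to the limit *)

Theorem proposition4 (R : realType) :
  convex_function (`]0, 1[%classic : set R) (@M R).
Proof.
apply: (@convex_function_lim _ _ (fun n => horner (euler_poly R n ^+ 3))).
- by move=> x y t; rewrite !inE; exact: conv_in_itv_oo.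
- by move=> n; apply: convex_horner => q; exact: euler_poly_cube_deriv2_ge0.
- move=> q; rewrite inE/= in_itv/= => q01; rewrite /M /infprod.
  under eq_fun do rewrite horner_exp horner_euler_poly.
  apply: (cvg_comp _ (fun x : R => x ^+ 3) (cvg_prod_1subXn q01)).
  exact: exprn_continuous.
Qed.
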